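(* For every $\mathbf M\in\mathbb{R}^3\setminus\{0\}$, there are infinitely many linearly independent $\omega\in C_c^\infty(Q)$ such that $$\int_Q\omega(x)\,\mathbf M\cdot\mathbf v(x)\,dx=0\qquad\text{for all }\mathbf v\in\mathcal H_{\lambda,\mu}.$$
   Context: Real constants $\lambda,\mu$ with $\mu>0$, $\lambda+2\mu>0$; $\mathcal L_{\lambda,\mu}\mathbf v=\mu\Delta\mathbf v+(\lambda+\mu)\nabla(\nabla\cdot\mathbf v)$; $\mathcal H_{\lambda,\mu}:=\{\mathbf v\in H^1_{\mathrm{loc}}(\mathbb{R}^3;\mathbb{C}^3):\mathcal L_{\lambda,\mu}\mathbf v=0\text{ in }\mathbb{R}^3\}$. $Q=D\times I\subset\mathbb{R}^3$ with $D\subset\mathbb{R}^2$ nonempty, bounded and open, and $I=(t_-,t_+)$ a bounded nonempty open interval. $\mathbf a\cdot\mathbf b=\sum_ka_kb_k$ (bilinear). *)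

(* Defs.v *)
From HB Require Import structures.
From mathcomp Require Import all_boot all_order all_algebra.
From mathcomp Require Import complex.
From mathcomp Require Import all_classical all_reals all_analysis.

Set Implicit Arguments.
Unset Strict Implicit.
Unset Printing Implicit Defensive.

Import Order.TTheory GRing.Theory Num.Theory.
Import numFieldNormedType.Exports.

Local Open Scope classical_set_scope.
Local Open Scope ring_scope.
Local Open Scope complex_scope.

(* R^3 is bracketed as R^2 x R, so that a cylinder D x I is D `*` I. *)
Notation space3 R := (R * R * R)%type.

Notation volume R :=
  ((@lebesgue_measure R \x @lebesgue_measure R) \x @lebesgue_measure R)%E.

Section Calculus.
Variable R : realType.
Implicit Types (f : space3 R -> R) (x : space3 R) (j : 'I_3).

Definition basis3 j : space3 R :=
  ((j == 0 :> nat)%:R, (j == 1 :> nat)%:R, (j == 2 :> nat)%:R).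

Definition partial j f : space3 R -> R := fun x => 'D_(basis3 j) f x.

Definition partials (s : seq 'I_3) f : space3 R -> R := foldr partial f s.

Definition smooth f : Prop :=
  forall s : seq 'I_3, continuous (partials s f) /\
    forall j x, derivable (partials s f) x (basis3 j).

Definition reC (g : space3 R -> R[i]) : space3 R -> R := fun x => complex.Re (g x).
Definition imC (g : space3 R -> R[i]) : space3 R -> R := fun x => complex.Im (g x).

Definition smoothC (g : space3 R -> R[i]) : Prop := smooth (reC g) /\ smooth (imC g).

Definition partialC j (g : space3 R -> R[i]) : space3 R -> R[i] :=
  fun x => partial j (reC g) x +i* partial j (imC g) x.

Definition integralC (A : set (space3 R)) (g : space3 R -> R[i]) : R[i] :=
  (\int[volume R]_(x in A) reC g x) +i* (\int[volume R]_(x in A) imC g x).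

Definition tsupport (g : space3 R -> R[i]) : set (space3 R) :=
  closure [set x | g x != 0].

(* C_c^oo(U; C) *)
Definition test_function (U : set (space3 R)) (g : space3 R -> R[i]) : Prop :=
  [/\ smoothC g, compact (tsupport g) & tsupport g `<=` U].

(* L^2_loc(R^3; C); every Lebesgue class has a Borel representative. *)
Definition L2loc (g : space3 R -> R[i]) : Prop :=
  [/\ measurable_fun setT (reC g), measurable_fun setT (imC g) &
      forall K, compact K -> (volume R).-integrable K
        (fun x => (reC g x ^+ 2 + imC g x ^+ 2)%:E)].

(* Distributions on R^3; only the values at test functions are meaningful. *)
Definition distribution3 := (space3 R -> R[i]) -> R[i].

Definition eq_distribution (S T : distribution3) : Prop :=
  forall phi, test_function setT phi -> S phi = T phi.

Definition regular_distribution (g : space3 R -> R[i]) : distribution3 :=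
  fun phi => integralC setT (fun x => g x * phi x).

Definition dpartial j (T : distribution3) : distribution3 :=
  fun phi => - T (partialC j phi).

(* H^1_loc(R^3; C) *)
Definition H1loc (g : space3 R -> R[i]) : Prop :=
  L2loc g /\ forall j, exists2 h, L2loc h &
    eq_distribution (dpartial j (regular_distribution g)) (regular_distribution h).

Definition component (v : space3 R -> 'rV[R[i]]_3) (k : 'I_3) : space3 R -> R[i] :=
  fun x => v x ord0 k.

Definition ddiv (v : 'I_3 -> distribution3) : distribution3 :=
  fun phi => \sum_(j < 3) dpartial j (v j) phi.

Definition dlaplacian (T : distribution3) : distribution3 :=
  fun phi => \sum_(j < 3) dpartial j (dpartial j T) phi.

(* mu Lap v + (lambda + mu) grad (div v), k-th component *)
Definition lame (lambda mu : R) (v : 'I_3 -> distribution3) (k : 'I_3) :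
    distribution3 :=
  fun phi => mu%:C * dlaplacian (v k) phi
    + (lambda + mu)%:C * dpartial k (ddiv v) phi.

Definition lame_solutions (lambda mu : R) : set (space3 R -> 'rV[R[i]]_3) :=
  [set v | (forall k, H1loc (component v k)) /\
     forall k, eq_distribution
       (lame lambda mu (fun j => regular_distribution (component v j)) k)
       (fun=> 0)].

Definition bilinear_dot (a b : 'rV[R[i]]_3) : R[i] :=
  \sum_(k < 3) a ord0 k * b ord0 k.

Definition complex_row (M : 'rV[R]_3) : 'rV[R[i]]_3 := map_mx (fun r => r%:C) M.

(* Linear independence over C of an infinite family of functions. *)
Definition linearly_independent (w : nat -> space3 R -> R[i]) : Prop :=
  forall n (c : 'I_n -> R[i]),
    (forall x, \sum_(i < n) c i * w i x = 0) -> forall i, c i = 0.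

End Calculus.

(* Main.v *)
(* If v solves the Lame system then every component of v is biharmonic in the
   weak sense, so omega = Lap^2(phi) annihilates M . v for each test function
   phi: as the Lame operator maps the test field
   (lambda + 2 mu) Lap(phi) M - (lambda + mu) grad (M . grad phi)
   to mu (lambda + 2 mu) Lap^2(phi) M, no regularity theory is needed.
   Taking phi(x) = f(x1) g(x2) h(x3) with bumps f, g, h makes all partial
   derivatives commute by inspection.  Such an omega does not vanish
   identically: for x2, x3 fixed at points where g, h <> 0, the equation
   Lap^2(phi) = 0 becomes f'''' = a f'' + b f, and uniqueness for the Cauchy
   problem at the left end of the support would force f = 0 nearby.  Bumps f
   with pairwise disjoint supports give linear independence. *)
Require Import Defs.
From HB Require Import structures.
From mathcomp Require Import all_boot all_order all_algebra.
From mathcomp Require Import complex.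
From mathcomp Require Import all_classical all_reals all_analysis.
From mathcomp Require Import measurable_realfun.
From mathcomp Require Import ring lra.

Set Implicit Arguments.
Unset Strict Implicit.
Unset Printing Implicit Defensive.

Import Order.TTheory GRing.Theory Num.Theory.
Import numFieldNormedType.Exports.

Local Open Scope classical_set_scope.
Local Open Scope ring_scope.
Local Open Scope complex_scope.

(** * Smooth functions and bumps on the real line *)

Section SmoothFunctionsOfOneVariable.
Local Open Scope classical_set_scope.
Variable R : realType.
Implicit Types (f g : R -> R) (t : R) (n : nat).

(** A finite order of differentiability allows induction: the derivative loses exactly one order, so
    sums, products and affine substitutions reduce to the Leibniz and chain rules. *)
Definition diff_times n f : Prop :=
  forall m, (m < n)%N -> forall t, derivable f^`(m) t 1.

Lemma diff_times0 f : diff_times 0 f.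
Proof. by move=> m; rewrite ltn0. Qed.

Lemma diff_timesS n f :
  (forall t, derivable f t 1) -> diff_times n f^`() -> diff_times n.+1 f.
Proof. by move=> df df' [_ //|m mn t]; rewrite derive1Sn; exact: df'. Qed.

Lemma diff_times1 n f t : diff_times n.+1 f -> derivable f t 1.
Proof. by move=> df; exact: (df 0%N). Qed.

Lemma diff_times_derive1 n f : diff_times n.+1 f -> diff_times n f^`().
Proof. by move=> df m mn t; rewrite -derive1Sn; exact: df. Qed.

Lemma diff_timesW n f : diff_times n.+1 f -> diff_times n f.
Proof. by move=> df m mn; apply: df; exact: ltnW. Qed.

Lemma diff_timesD n f g :
  diff_times n f -> diff_times n g -> diff_times n (f + g).
Proof.
elim: n f g => [|n IHn] f g df dg; first exact: diff_times0.
apply: diff_timesS => [t|]; first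
  exact: (derivableD (diff_times1 df) (diff_times1 dg)).
have -> : (f + g)^`() = derive1 f + derive1 g.
  by apply/funext => t; rewrite derive1E;
    rewrite (deriveD (diff_times1 df) (diff_times1 dg)) -!derive1E.
by apply: IHn; exact: diff_times_derive1.
Qed.

Lemma diff_timesZ n (a : R) f : diff_times n f -> diff_times n (a \*: f).
Proof.
elim: n f => [|n IHn] f df; first exact: diff_times0.
apply: diff_timesS => [t|]; first exact: (derivableZ (diff_times1 df)).
have -> : (a \*: f)^`() = a \*: derive1 f.
  apply/funext => t.
  by rewrite derive1E (deriveZ _ (diff_times1 df)) -!derive1E.
by apply: IHn; exact: diff_times_derive1.
Qed.

Lemma diff_timesM n f g :
  diff_times n f -> diff_times n g -> diff_times n (f * g).
Proof.
elim: n f g => [|n IHn] f g df dg; first exact: diff_times0.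
apply: diff_timesS => [t|]; first
  exact: (derivableM (diff_times1 df) (diff_times1 dg)).
have -> : (f * g)^`() = f * derive1 g + g * derive1 f.
  by apply/funext => t; rewrite derive1E;
    rewrite (deriveM (diff_times1 df) (diff_times1 dg)) -!derive1E.
by apply: diff_timesD; apply: IHn;
  [exact: diff_timesW|exact: diff_times_derive1
  |exact: diff_timesW|exact: diff_times_derive1].
Qed.

Lemma diff_times_affine n (a b : R) f :
  diff_times n f -> diff_times n (fun t => f (a * t + b)).
Proof.
elim: n f => [|n IHn] f df; first exact: diff_times0.
have dfa t : is_derive t 1 (fun t => f (a * t + b)) (derive1 f (a * t + b) * a).
  have h : is_derive t 1 (fun t => a * t + b) a.
    have -> : (fun t => a * t + b) = a \*: (@id R) + cst b by [].
    apply: (is_derive_eq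
      (is_deriveD (is_deriveZ a (is_derive_id t 1)) (is_derive_cst b t 1))).
    by rewrite addr0 [LHS]mulr1.
  have := @is_derive1_comp _ f (fun t => a * t + b) t _ _ _ h.
  apply; rewrite derive1E; exact/derivableP/(diff_times1 df).
apply: diff_timesS => [t|]; first exact: ex_derive.
have -> : (fun t => f (a * t + b))^`() = a \*: (fun t => derive1 f (a * t + b)).
  by apply/funext => t; rewrite derive1E derive_val mulrC.
by apply/diff_timesZ/IHn/diff_times_derive1.
Qed.

(** The classical flat function exp(-1/t), weighted by t^(-k). The whole family in [k] is considered
    because differentiation maps it into its own linear span. *)
Definition flat (k : nat) t : R :=
  if 0 < t then t^-1 ^+ k * expR (- t^-1) else 0.

Lemma flat_le0 k t : t <= 0 -> flat k t = 0.
Proof. by rewrite leNgt /flat => /negbTE ->. Qed.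

Lemma flat_gt0 k t : 0 < t -> 0 < flat k t.
Proof.
by move=> t0; rewrite /flat t0 mulr_gt0 ?expR_gt0 ?exprn_gt0 ?invr_gt0.
Qed.

(** With u = 1/t > 0, the exponential series gives exp(u) >= u^(k+1) / (k+1)!. This linear bound is
    what yields differentiability at 0. *)
Lemma norm_flat_le k t : `|flat k t| <= k.+1`!%:R * `|t|.
Proof.
have [t0|t0] := lerP t 0; first by rewrite flat_le0 ?normr0 ?mulr_ge0.
rewrite !gtr0_norm ?flat_gt0// /flat t0 expRN ler_pdivrMr ?expR_gt0//.
rewrite -[leRHS]mulrA -ler_pdivrMl ?ltr0n ?fact_gt0//.
rewrite -ler_pdivrMl//.
have := @expR_ge1Dxn R t^-1 k; rewrite invr_ge0 ltW// => /(_ isT).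
apply: le_trans; rewrite exprS -[leLHS]add0r lerD// mulrCA mulrA mulrC mulrA.
by rewrite mulrC -!mulrA lexx.
Qed.

Lemma is_derive_flat k t :
  is_derive t 1 (flat k) (flat k.+2 t - k%:R * flat k.+1 t).
Proof.
have [t0|t0|->] := ltgtP t 0.
- rewrite !flat_le0 ?ltW// mulr0 subr0.
  apply: (@near_eq_is_derive _ _ _ (cst 0)).
  near=> x; rewrite flat_le0//; near: x; exact: lt_le_nbhsl.
- have t0' : t != 0 by rewrite gt_eqF.
  have dV : is_derive t 1 (fun x : R => x^-1) (- t ^- 2).
    apply: (is_derive_eq (is_deriveV t0' (is_derive_id t 1))).
    by rewrite [LHS]mulr1.
  have dE := @is_derive1_comp _ expR _ t _ _ (is_derive_expR _) (is_deriveN dV).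
  have dX := is_deriveX k dV; rewrite exprfctE in dX.
  have D := is_deriveM dX dE.
  have E : t^-1 ^+ k *: (expR (- t^-1) * - - t ^- 2) +
      expR (- t^-1) *: ((k%:R * t^-1 ^+ k.-1) *: - t ^- 2) =
      flat k.+2 t - k%:R * flat k.+1 t.
    rewrite /flat t0 -exprVn opprK /GRing.scale /=.
    by case: k {D dX} => [|k]; rewrite /= ?exprS; ring.
  apply: (near_eq_is_derive _ (is_derive_eq D E)).
  near=> x; rewrite /flat ifT//; near: x; exact: lt_nbhsr.
- rewrite !flat_le0// mulr0 subr0.
  (* The difference quotient of [flat k] at 0 is [flat k.+1] itself, which tends to 0 by the linear
     bound. *)
  have h : (fun h => h^-1 *: ((flat k \o shift 0) (h *: 1) - flat k 0))
      @ 0^' --> (0 : R).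
    have -> : (fun h => h^-1 *: ((flat k \o shift 0) (h *: 1) - flat k 0)) =
        (flat k.+1).
      apply/funext => h /=; rewrite [h *: 1]mulr1 addr0 (@flat_le0 k 0)// subr0.
      rewrite /flat; case: ifP => _; last by rewrite scaler0.
      by rewrite [LHS]mulrA exprS.
    apply/cvgr0Pnorm_le => e e0; near=> x.
    apply: (le_trans (norm_flat_le _ _)).
    rewrite -ler_pdivlMl ?ltr0n ?fact_gt0//.
    near: x; apply: dnbhs0_le.
    by rewrite mulr_gt0// invr_gt0 ltr0n fact_gt0.
  apply: DeriveDef; last exact/cvg_lim.
  by apply/cvg_ex; exists 0.
Unshelve. all: by end_near. Qed.

Lemma diff_times_flat n k : diff_times n (flat k).
Proof.
elim: n k => [|n IHn] k; first exact: diff_times0.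
have d t := @is_derive_flat k t.
apply: diff_timesS => [t|]; first exact: ex_derive.
have -> : (flat k)^`() = flat k.+2 + (- k%:R) \*: flat k.+1.
  by apply/funext => t; rewrite derive1E derive_val fctE -mulNr.
by apply: diff_timesD => //; exact: diff_timesZ.
Qed.

Definition smooth1 f : Prop := forall n, diff_times n f.

Lemma smooth1_derivable f n t : smooth1 f -> derivable f^`(n) t 1.
Proof. by move=> /(_ n.+1); exact. Qed.

Lemma smooth1_continuous f n : smooth1 f -> continuous f^`(n).
Proof.
move=> sf t; apply/differentiable_continuous/derivable1_diffP.
exact: smooth1_derivable.
Qed.

Definition bump (p q t : R) : R := flat 0 (t - p) * flat 0 (q - t).

Lemma smooth1_bump p q : smooth1 (bump p q).
Proof.
move=> n; have := diff_timesM
  (@diff_times_affine n 1 (- p) _ (@diff_times_flat n 0))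
  (@diff_times_affine n (-1) q _ (@diff_times_flat n 0)).
congr diff_times; apply/funext => t; rewrite fctE /bump mul1r mulN1r.
by rewrite [- t + q]addrC.
Qed.

Lemma bump_gt0 p q t : p < t < q -> 0 < bump p q t.
Proof. by move=> /andP[? ?]; rewrite mulr_gt0// flat_gt0// subr_gt0. Qed.

(** The complement of the closed interval is open, so [f] is locally constant there and the
    condition passes to all derivatives. *)
Definition zero_off f (p q : R) : Prop := forall t, ~~ (p <= t <= q) -> f t = 0.

Lemma bump_zero_off p q : zero_off (bump p q) p q.
Proof.
move=> t; rewrite negb_and -!ltNge /bump => /orP[|] h.
  by rewrite flat_le0 ?mul0r// subr_le0 ltW.
by rewrite mulrC flat_le0 ?mul0r// subr_le0 ltW.
Qed.

Lemma derive1_zero_off f p q : zero_off f p q -> zero_off f^`() p q.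
Proof.
move=> f0 t; rewrite negb_and -!ltNge => ht.
rewrite derive1E (@near_eq_derive _ _ _ _ (cst 0)) ?derive_cst//.
case/orP: ht => ht; near=> x; apply: f0; rewrite negb_and -!ltNge;
  apply/orP; [left|right]; near: x; [exact: lt_nbhsl|exact: lt_nbhsr].
Unshelve. all: by end_near. Qed.

Lemma derive1n_zero_off f n p q : zero_off f p q -> zero_off f^`(n) p q.
Proof.
by move=> f0; elim: n => [//|n IHn]; rewrite derive1nS; exact: derive1_zero_off.
Qed.

(** The extreme value theorem on [p, q]; when q < p the function is identically 0. The bound later
    makes products with locally square integrable functions integrable. *)
Lemma smooth1_bounded f n p q : smooth1 f -> zero_off f p q ->
  exists2 C, 0 <= C & forall t, `|f^`(n) t| <= C.
Proof.
move=> sf /(@derive1n_zero_off _ n) f0.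
have [pq|qp] := lerP p q; last first.
  exists 0 => // t; rewrite f0 ?normr0// negb_and -!ltNge.
  by case: (ltrP t p) => //= pt; exact: lt_le_trans pt.
have cf : {within `[p, q], continuous (fun t => `|f^`(n) t|)}.
  apply: continuous_subspaceT => t; apply: cvg_norm.
  exact: smooth1_continuous.
have [c _ hc] := EVT_max pq cf.
exists `|f^`(n) c| => // t.
have [tpq|tpq] := boolP (p <= t <= q); first by apply: hc; rewrite in_itv.
by rewrite f0// normr0.
Qed.

End SmoothFunctionsOfOneVariable.

(** * Uniqueness for a fourth-order linear Cauchy problem *)

Section VanishingOfCauchyProblem.
Variable R : realType.
Local Open Scope classical_set_scope.

(** Mean value theorem between the zero [s] of the [n]-th derivative and t. *)
Lemma norm_derive1n_le (f : R -> R) n (s e C : R) : smooth1 f ->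
  f^`(n) s = 0 -> (forall t, s <= t <= e -> `|f^`(n.+1) t| <= C) ->
  forall t, s <= t <= e -> `|f^`(n) t| <= C * (e - s).
Proof.
move=> sf fs0 fC t /andP[st te].
have C0 : 0 <= C.
  by apply: le_trans (fC s _); rewrite ?normr_ge0// lexx (le_trans st).
have df x : x \in `]s, t[%R -> is_derive x 1 f^`(n) (f^`(n.+1) x).
  by move=> _; rewrite derive1nS derive1E; apply/derivableP/smooth1_derivable.
have cf : {within `[s, t], continuous f^`(n)}.
  by apply: continuous_subspaceT; exact: smooth1_continuous.
have [c + E] := MVT_segment st df cf.
rewrite in_itv/= => /andP[sc ct].
rewrite -[f^`(n) t]subr0 -fs0 E normrM [X in _ * X]ger0_norm ?subr_ge0//.
apply: ler_pM; rewrite ?normr_ge0 ?subr_ge0 ?lerD2r//.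
by apply: fC; rewrite sc (le_trans ct).
Qed.

(* If L is the length of a short interval around p and M the maximum of |f''''|
   there, then |f|, |f''| <= L M by the mean value theorem, and the equation
   gives M <= (|a| + |b|) L M <= M / 2. *)
Lemma fourth_order_Cauchy0 (f : R -> R) (p a b : R) : smooth1 f ->
  (forall t, t <= p -> f t = 0) ->
  (forall t, derive1n 4 f t = a * derive1n 2 f t + b * f t) ->
  exists2 d, 0 < d & forall t, p < t < p + d -> f t = 0.
Proof.
move=> sf f0 ode.
have fn0 n t : t < p -> f^`(n) t = 0.
  elim: n t => [|n IHn] t tp; first exact/f0/ltW.
  rewrite derive1nS derive1E (@near_eq_derive _ _ _ _ (cst 0)) ?derive_cst//.
  by near=> x; apply: IHn; near: x; exact: lt_nbhsl.
(* Chosen so that the interval of length 2 d satisfies 2 d (|a| + |b|) <= 1/2 and 2 d <= 1. *)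
pose d := (4 * (`|a| + `|b| + 1))^-1.
have den : 0 < `|a| + `|b| + 1 by rewrite ltr_wpDl// addr_ge0.
have d0 : 0 < d by rewrite invr_gt0 mulr_gt0.
exists d => // t /andP[pt tpd].
(* The interval starts strictly to the left of [p], where all derivatives vanish because [f] is
   locally 0. *)
pose s := p - d; pose e := p + d.
have sp : s < p by rewrite /s gtrBl.
have es : e - s = 2 * d by rewrite /e /s; ring.
have dK : 2 * (d * (`|a| + `|b|)) = 2^-1 - 2 * d.
  by rewrite /d; field; rewrite gt_eqF.
have L1 : 2 * d <= 1.
  have : 0 <= d * (`|a| + `|b|) by rewrite mulr_ge0 ?addr_ge0// ltW.
  by have := d0; lra.
have cf : {within `[s, e], continuous (fun t => `|f^`(4) t|)}.
  apply: continuous_subspaceT => x; apply: cvg_norm.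
  exact: smooth1_continuous.
have se : s <= e by rewrite -subr_ge0 es mulr_ge0 ?ltW.
have [c cse hc] := EVT_max se cf.
have [M EM] : exists M, M = `|f^`(4) c| by exists `|f^`(4) c|.
have d2 : 0 <= 2 * d by rewrite mulr_ge0// ltW.
have M0 : 0 <= M by rewrite EM normr_ge0.
have h4 x : s <= x <= e -> `|f^`(4) x| <= M.
  by move=> xse; rewrite EM; apply: hc; rewrite in_itv.
(* Descending one more order multiplies the bound by 2 d <= 1, so the same bound is kept. *)
have step n : (forall x, s <= x <= e -> `|f^`(n.+1) x| <= M * (2 * d)) ->
    forall x, s <= x <= e -> `|f^`(n) x| <= M * (2 * d).
  move=> h x xse; have := norm_derive1n_le sf (fn0 n s sp) h xse.
  by rewrite es => /le_trans; apply; exact: (ler_piMr (mulr_ge0 M0 d2) L1).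
have h3 x : s <= x <= e -> `|f^`(3) x| <= M * (2 * d).
  by rewrite -es; exact: (norm_derive1n_le sf (fn0 3%N s sp) h4).
have h2 := step 2%N h3.
have hf := step 0%N (step 1%N h2).
have M00 : M = 0.
  move: cse; rewrite in_itv/= => cse.
  have : M <= `|a| * (M * (2 * d)) + `|b| * (M * (2 * d)).
    rewrite {1}EM ode (le_trans (ler_normD _ _))// !normrM.
    by apply: lerD; rewrite ler_wpM2l// ?h2 ?hf.
  have -> : `|a| * (M * (2 * d)) + `|b| * (M * (2 * d)) =
      M * (2 * (d * (`|a| + `|b|))) by ring.
  have : 0 <= M * (2 * d) by rewrite mulr_ge0.
  by rewrite dK mulrBr; lra.
have := hf t; rewrite M00 mul0r => /(_ _)/wrap[].
  by rewrite /s /e; apply/andP; split; have := d0; lra.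
by rewrite normr_le0 => /eqP.
Unshelve. all: by end_near. Qed.

End VanishingOfCauchyProblem.

(** * Products of functions of one variable each *)

Section Tensors.
Variable R : realType.
Local Open Scope classical_set_scope.
Implicit Types (f g h : R -> R) (x : space3 R) (j : 'I_3).

Definition tens f g h : space3 R -> R := fun x => f x.1.1 * g x.1.2 * h x.2.

(* Along [basis3 R j] only one factor varies, and the difference quotient of
   the product is that of this factor times a constant. *)
Lemma is_derive_tens f g h j x :
  derivable f x.1.1 1 -> derivable g x.1.2 1 -> derivable h x.2 1 ->
  is_derive x (basis3 R j) (tens f g h)
    (tens (derive1n (j == 0 :> nat) f) (derive1n (j == 1 :> nat) g)
          (derive1n (j == 2 :> nat) h) x).
Proof.
move=> df dg dh.
have slice (u : R -> R) a c (v : space3 R) (F : space3 R -> R) :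
    derivable u a 1 -> (forall t, F (t *: v + x) = u (t + a) * c) ->
    is_derive x v F (derive1 u a * c).
  move=> du Fu.
  have Fx : F x = u a * c by rewrite -[a in RHS]add0r -Fu scale0r add0r.
  have E : (fun t => t^-1 *: ((F \o shift x) (t *: v) - F x)) =
      (fun t => (t^-1 *: ((u \o shift a) (t *: (1 : R)) - u a)) * c).
    apply/funext => t /=; rewrite Fu Fx [t *: 1]mulr1 -mulrBl.
    by rewrite [LHS]mulrA.
  have cv : (fun t => t^-1 *: ((F \o shift x) (t *: v) - F x)) @ 0^' -->
      derive1 u a * c.
    by rewrite E derive1E; apply: cvgMl; exact: du.
  apply: DeriveDef; last exact/cvg_lim.
  by apply/cvg_ex; exists (derive1 u a * c).
case: x df dg dh slice => [[x y] z] /= df dg dh slice; rewrite /tens /=.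
case: j => [[|[|[|//]]] p] /=; rewrite /basis3 /=.
- rewrite -[_ * _ * _]mulrA; apply: slice => // t /=.
  by rewrite [t *: 1]mulr1 [t *: 0]mulr0 !add0r mulrA.
- rewrite [_ * derive1 g y]mulrC -[_ * _ * _]mulrA; apply: slice => // t /=.
  by rewrite [t *: 1]mulr1 [t *: 0]mulr0 !add0r; ring.
- rewrite mulrC; apply: slice => // t /=.
  by rewrite [t *: 1]mulr1 [t *: 0]mulr0 !add0r; ring.
Qed.

Lemma continuous_tens f g h :
  continuous f -> continuous g -> continuous h -> continuous (tens f g h).
Proof.
move=> cf cg ch x; rewrite /tens.
apply: (@cvgM _ _ _ _ (fun x => f x.1.1 * g x.1.2) (fun x => h x.2)).
  apply: (@cvgM _ _ _ _ (fun x => f x.1.1) (fun x => g x.1.2)).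
    apply: (@continuous_comp _ _ _ (fun x : space3 R => x.1.1) f);
      last exact: cf.
    by apply: continuous_comp; exact: cvg_fst.
  apply: (@continuous_comp _ _ _ (fun x : space3 R => x.1.2) g); last exact: cg.
  by apply: continuous_comp; [exact: cvg_fst|exact: cvg_snd].
apply: (@continuous_comp _ _ _ (fun x : space3 R => x.2) h); last exact: ch.
exact: cvg_snd.
Qed.

Lemma measurable_tens f g h : continuous f -> continuous g -> continuous h ->
  measurable_fun setT (tens f g h).
Proof.
move=> /continuous_measurable_fun mf
  /continuous_measurable_fun mg
  /continuous_measurable_fun mh.
apply: measurable_funM; first apply: measurable_funM.
- apply: (measurableT_comp mf).
  by apply: measurableT_comp; exact: measurable_fst.
- apply: (measurableT_comp mg).
  by apply: measurableT_comp; [exact: measurable_snd|exact: measurable_fst].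
- by apply: (measurableT_comp mh); exact: measurable_snd.
Qed.

End Tensors.

(** * Constant-coefficient differential operators applied to a product of bumps *)

Section TensorDerivatives.
Variable R : realType.
Local Open Scope classical_set_scope.
Variables (f g h : R -> R) (p q : space3 R).
Hypotheses (sf : smooth1 f) (sg : smooth1 g) (sh : smooth1 h).
Hypotheses (f0 : zero_off f p.1.1 q.1.1) (g0 : zero_off g p.1.2 q.1.2)
  (h0 : zero_off h p.2 q.2).
(* The sigma-algebra of [volume R]: convertible to that of [space3 R], under a
   different [measure_display]. *)
Local Notation mspace3 :=
  (measurableTypeR R * measurableTypeR R * measurableTypeR R)%type.
Implicit Types (x : space3 R) (j : 'I_3) (k : nat * nat * nat)
  (l : seq (R * (nat * nat * nat))).

Definition dtens k : space3 R -> R :=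
  tens f^`(k.1.1) g^`(k.1.2) h^`(k.2).

(** The list encodes a differential operator as pairs of a coefficient and a multi-index, applied to
    f(x1) g(x2) h(x3). Partial derivatives then act on the list alone, through [dincr]. *)
Definition dcomb l : space3 R -> R := fun x => \sum_(c <- l) c.1 * dtens c.2 x.

Definition incr j k : nat * nat * nat :=
  ((j == 0 :> nat) + k.1.1, (j == 1 :> nat) + k.1.2, (j == 2 :> nat) + k.2)%N.

Definition dincr j l := [seq (c.1, incr j c.2) | c <- l].

Definition box : set (space3 R) :=
  `[p.1.1, q.1.1] `*` `[p.1.2, q.1.2] `*` `[p.2, q.2].

Lemma is_derive_dtens j k x :
  is_derive x (basis3 R j) (dtens k) (dtens (incr j k) x).
Proof.
rewrite /dtens /incr /= /derive1n !iterD.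
by apply: is_derive_tens; exact: smooth1_derivable.
Qed.

Lemma is_derive_dcomb j l x :
  is_derive x (basis3 R j) (dcomb l) (dcomb (dincr j l) x).
Proof.
elim: l => [|c l IHl].
  have -> : dcomb [::] = cst 0 by apply/funext => y; rewrite /dcomb big_nil.
  exact: is_derive_cst.
have -> : dcomb (c :: l) = c.1 \*: dtens c.2 + dcomb l.
  by apply/funext => y; rewrite /dcomb big_cons fctE.
have := is_deriveD (is_deriveZ c.1 (is_derive_dtens j c.2 x)) IHl.
by rewrite /dcomb /= big_cons.
Qed.

Lemma partial_dcomb j l : partial j (dcomb l) = dcomb (dincr j l).
Proof.
by apply/funext => x; have d := is_derive_dcomb j l x; exact: derive_val.
Qed.

Lemma continuous_dtens k : continuous (dtens k).
Proof. by apply: continuous_tens; exact: smooth1_continuous. Qed.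

Lemma continuous_dcomb l : continuous (dcomb l).
Proof.
elim: l => [|c l IHl] x.
  have -> : dcomb [::] = cst 0 by apply/funext => y; rewrite /dcomb big_nil.
  exact: cvg_cst.
have -> : dcomb (c :: l) = c.1 \*: dtens c.2 + dcomb l.
  by apply/funext => y; rewrite /dcomb big_cons fctE.
by apply: cvgD; [apply: cvgZr; exact: continuous_dtens|exact: IHl].
Qed.

Lemma smooth_dcomb l : smooth (dcomb l).
Proof.
move=> s; have [l' ->] : exists l', partials s (dcomb l) = dcomb l'.
  elim: s => [|j s [l' E]]; first by exists l.
  by exists (dincr j l'); rewrite /= E partial_dcomb.
by split=> [|j x]; [exact: continuous_dcomb|
  have d := is_derive_dcomb j l' x; exact: ex_derive].
Qed.

Lemma measurable_dcomb l : measurable_fun [set: mspace3] (dcomb l).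
Proof.
suff : measurable_fun [set: space3 R] (dcomb l) by [].
rewrite /dcomb; apply: measurable_sum => c.
apply: measurable_funM; first exact: measurable_cst.
by apply: measurable_tens; exact: smooth1_continuous.
Qed.

Lemma dcomb_off_box l x : ~ box x -> dcomb l x = 0.
Proof.
move=> bx; rewrite /dcomb big1// => c _.
suff -> : dtens c.2 x = 0 by rewrite mulr0.
rewrite /dtens /tens; apply: contra_notP bx => /eqP.
rewrite !mulf_eq0 !negb_or => /andP[/andP[fx gx] hx].
split; first split; rewrite /= in_itv/=.
- by apply: contraNT fx => /(derive1n_zero_off _ f0) ->.
- by apply: contraNT gx => /(derive1n_zero_off _ g0) ->.
- by apply: contraNT hx => /(derive1n_zero_off _ h0) ->.
Qed.

Lemma dcomb_bounded l : exists2 C, 0 <= C & forall x, `|dcomb l x| <= C.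
Proof.
elim: l => [|c l [C C0 hC]].
  by exists 0 => // x; rewrite /dcomb big_nil normr0.
have [Cf Cf0 hf] := @smooth1_bounded _ _ c.2.1.1 _ _ sf f0.
have [Cg Cg0 hg] := @smooth1_bounded _ _ c.2.1.2 _ _ sg g0.
have [Ch Ch0 hh] := @smooth1_bounded _ _ c.2.2 _ _ sh h0.
exists (`|c.1| * (Cf * Cg * Ch) + C) => [|x].
  by rewrite addr_ge0// !mulr_ge0.
rewrite /dcomb big_cons (le_trans (ler_normD _ _))// lerD//; last exact: hC.
rewrite /dtens /tens !normrM ler_wpM2l//.
by do 2?[apply: ler_pM => //]; rewrite ?mulr_ge0.
Qed.

Lemma compact_box : compact box.
Proof. by do 2?[apply: compact_setX]; exact: segment_compact. Qed.

Lemma closed_box : closed box.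
Proof. by apply: compact_closed compact_box; exact: norm_hausdorff. Qed.

Lemma measurable_box : measurable (box : set mspace3).
Proof. by do 2?[apply: measurableX]; exact: measurable_itv. Qed.

Lemma volume_box : (volume R box < +oo)%E.
Proof.
rewrite /box product_measure1E//; last exact: measurableX.
rewrite [X in (X * _)%E](_ : _ = lebesgue_measure `[p.1.1, q.1.1]%classic *
  lebesgue_measure `[p.1.2, q.1.2]%classic)%E; last exact: product_measure1E.
have fin (a b : R) : (@lebesgue_measure R `[a, b]%classic \is a fin_num)%E.
  by rewrite lebesgue_measure_itv; case: ifP.
by rewrite ltey_eq !fin_numM ?fin.
Qed.

Definition toC (F : space3 R -> R) : space3 R -> R[i] := fun x => (F x)%:C.

Lemma partialC_dcomb j l :
  partialC j (toC (dcomb l)) = toC (dcomb (dincr j l)).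
Proof.
apply/funext => x; rewrite /partialC -partial_dcomb /toC; congr (_ +i* _).
(* The zero imaginary part is the empty combination, so [partial_dcomb] covers it as well. *)
have -> : imC (fun x => (dcomb l x)%:C) = dcomb [::].
  by apply/funext => y; rewrite /dcomb big_nil.
by rewrite partial_dcomb /dcomb /= big_nil.
Qed.

Lemma test_function_dcomb l U : box `<=` U -> test_function U (toC (dcomb l)).
Proof.
move=> KU.
have KT : tsupport (toC (dcomb l)) `<=` box.
  rewrite (iffLR (closure_id box) closed_box); apply: closure_subset => x /=.
  by apply: contra_neqP => /(@dcomb_off_box l); rewrite /toC => ->.
split; last exact: subset_trans KU.
- split; first exact: smooth_dcomb.
  have -> : imC (toC (dcomb l)) = dcomb [::].
    by apply/funext => y; rewrite /dcomb big_nil.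
  exact: smooth_dcomb.
- apply: subclosed_compact compact_box KT; exact: closed_closure.
Qed.

(** [w] will be the real or imaginary part of a component of the Lame solution, and [s] the squared
    modulus of that component. *)
Variables (w s : space3 R -> R).
Hypotheses (mw : measurable_fun setT w) (ws : forall x, w x ^+ 2 <= s x)
  (ints : (volume R).-integrable box (EFin \o s)).

(** On the box, of finite volume, |w| <= 1 + w^2 <= 1 + s and the other factor is at most C; off the
    box the product is 0. Hence C (1 + s), cut off to the box, dominates. *)
Lemma integrable_mul_dcomb l :
  (volume R).-integrable setT (EFin \o (fun x => w x * dcomb l x)).
Proof.
have [C C0 hC] := dcomb_bounded l.
have mb := measurable_box.
have mw' : measurable_fun [set: mspace3] w by [].
have i1 : (volume R).-integrable box (EFin \o cst (1 : R)).
  apply/integrableP; split; first exact/measurable_EFinP/measurable_cst.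
  under eq_integral do rewrite /= normr1.
  by rewrite integral_cst// mul1e; exact: volume_box.
have i2 : (volume R).-integrable box (EFin \o (fun x => C * (1 + s x))).
  have := integrableZl mb C (integrableD mb i1 ints).
  by apply: eq_integrable => // x _ /=; rewrite -EFinD -EFinM.
move/(integrable_mkcond _ mb) : i2.
apply: le_integrable => //.
  apply/measurable_EFinP; apply: measurable_funM => //.
  exact: measurable_dcomb.
move=> x _; rewrite /patch; case: ifPn => [_|]; last first.
  by rewrite notin_setE => /(@dcomb_off_box l) /= ->; rewrite mulr0 normr0.
rewrite /= lee_fin normrM [leRHS]ger0_norm; last first.
  by rewrite mulr_ge0// addr_ge0// (le_trans (sqr_ge0 _) (ws x)).
rewrite mulrC ler_pM// (le_trans _ (_ : 1 + w x ^+ 2 <= _)) ?lerD//.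
rewrite -[w x ^+ 2]real_normK ?num_real//.
by have := sqr_ge0 (`|w x| - 1); rewrite sqrrB1; have := normr_ge0 (w x); lra.
Qed.

Definition pairing (F : space3 R -> R) : R := \int[volume R]_x (w x * F x).

Lemma pairing_dcomb l :
  pairing (dcomb l) = \sum_(c <- l) c.1 * pairing (dtens c.2).
Proof.
elim: l => [|c l IHl].
  rewrite /pairing big_nil; under eq_Rintegral do rewrite /dcomb big_nil mulr0.
  by rewrite Rintegral_cst ?mul0r.
(* A one-term combination, so that [integrable_mul_dcomb] applies to it. *)
have E k : dtens k = dcomb [:: (1, k)].
  by apply/funext => x; rewrite /dcomb big_seq1 mul1r.
rewrite big_cons -IHl /pairing.
under eq_Rintegral do rewrite /dcomb big_cons mulrDr mulrCA.
rewrite RintegralD//=; last exact: integrable_mul_dcomb.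
  rewrite RintegralZl// E; exact: integrable_mul_dcomb.
rewrite E.
have := integrableZl measurableT c.1 (integrable_mul_dcomb [:: (1, c.2)]).
by apply: eq_integrable => // x _ /=; rewrite -EFinM.
Qed.

End TensorDerivatives.

(** * The algebraic identity behind weak biharmonicity *)

Section LameAlgebra.
Variable R : realType.

(** The expansion of the square of the Laplacian symbol, (d1^2 + d2^2 + d3^2)^2. *)
Definition bilaplacian : seq (R * (nat * nat * nat)) :=
  [:: (1, (4, 0, 0)%N); (1, (0, 4, 0)%N); (1, (0, 0, 4)%N);
      (2, (2, 2, 0)%N); (2, (2, 0, 2)%N); (2, (0, 2, 2)%N)].

(* With [tau j k] standing for the pairing of [v_j] with the derivative of
   [phi] of multi-index [k], this says that the Lame operator maps
   (lambda + 2 mu) Lap(phi) M - (lambda + mu) grad (M . grad phi)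
   to mu (lambda + 2 mu) Lap^2(phi) M. *)
Lemma sum_bilaplacian_eq0 (lambda mu : R) (m : 'I_3 -> R)
    (tau : 'I_3 -> nat * nat * nat -> R) :
  0 < mu -> 0 < lambda + 2 * mu ->
  (forall (i : 'I_3) k,
     mu * \sum_(j < 3) tau i (incr j (incr j k)) +
     (lambda + mu) * \sum_(j < 3) tau j (incr j (incr i k)) = 0) ->
  \sum_(j < 3) m j * \sum_(c <- bilaplacian) c.1 * tau j c.2 = 0.
Proof.
move=> mu0 lm0 h.
apply: (mulfI (_ : mu * (lambda + 2 * mu) != 0)).
  by rewrite mulf_neq0// gt_eqF.
pose o0 : 'I_3 := ord0; pose o1 : 'I_3 := @Ordinal 3 1 isT.
pose o2 : 'I_3 := @Ordinal 3 2 isT.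
have sum3 (F : 'I_3 -> R) : \sum_(j < 3) F j = F o0 + F o1 + F o2.
  rewrite !big_ord_recr big_ord0 /= add0r.
  by congr (F _ + F _ + F _); exact/val_inj.
(* [L0], [L1], [L2] are the three components of the Lame equation tested with the derivative of
   multi-index (x, y, z). *)
pose L0 x y z :=
  mu * (tau o0 (x.+2, y, z) + tau o0 (x, y.+2, z) + tau o0 (x, y, z.+2)) +
  (lambda + mu) *
    (tau o0 (x.+2, y, z) + tau o1 (x.+1, y.+1, z) + tau o2 (x.+1, y, z.+1)).
pose L1 x y z :=
  mu * (tau o1 (x.+2, y, z) + tau o1 (x, y.+2, z) + tau o1 (x, y, z.+2)) +
  (lambda + mu) *
    (tau o0 (x.+1, y.+1, z) + tau o1 (x, y.+2, z) + tau o2 (x, y.+1, z.+1)).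
pose L2 x y z :=
  mu * (tau o2 (x.+2, y, z) + tau o2 (x, y.+2, z) + tau o2 (x, y, z.+2)) +
  (lambda + mu) *
    (tau o0 (x.+1, y, z.+1) + tau o1 (x, y.+1, z.+1) + tau o2 (x, y, z.+2)).
have L00 x y z : L0 x y z = 0 by rewrite -(h o0 (x, y, z)) !sum3.
have L10 x y z : L1 x y z = 0 by rewrite -(h o1 (x, y, z)) !sum3.
have L20 x y z : L2 x y z = 0 by rewrite -(h o2 (x, y, z)) !sum3.
rewrite sum3 !big_cons !big_nil /= mulr0.
pose lap (L : nat -> nat -> nat -> R) :=
  L 2%N 0%N 0%N + L 0%N 2%N 0%N + L 0%N 0%N 2%N.
(* The first group tests the equation with Lap(phi) M, the second with grad (M . grad phi), whose
   i-th component is the sum over j of m_j d_i d_j phi. The mixed terms cancel. *)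
transitivity ((lambda + 2 * mu) *
    (m o0 * lap L0 + m o1 * lap L1 + m o2 * lap L2) -
  (lambda + mu) *
    (m o0 * (L0 2%N 0%N 0%N + L1 1%N 1%N 0%N + L2 1%N 0%N 1%N) +
     m o1 * (L0 1%N 1%N 0%N + L1 0%N 2%N 0%N + L2 0%N 1%N 1%N) +
     m o2 * (L0 1%N 0%N 1%N + L1 0%N 1%N 1%N + L2 0%N 0%N 2%N))).
  by rewrite /lap /L0 /L1 /L2; ring.
by rewrite /lap !L00 !L10 !L20; ring.
Qed.

End LameAlgebra.

(** * Lame solutions paired with derivatives of a product of bumps *)

Section LamePairing.
Variable R : realType.
Local Open Scope classical_set_scope.
Variables (f g h : R -> R) (p q : space3 R).
Hypotheses (sf : smooth1 f) (sg : smooth1 g) (sh : smooth1 h).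
Hypotheses (f0 : zero_off f p.1.1 q.1.1) (g0 : zero_off g p.1.2 q.1.2)
  (h0 : zero_off h p.2 q.2).
Variables (lambda mu : R) (v : space3 R -> 'rV[R[i]]_3).
Hypothesis lame_v : lame_solutions lambda mu v.

Let re (j : 'I_3) : space3 R -> R := reC (component v j).
Let im (j : 'I_3) : space3 R -> R := imC (component v j).
Let D := dtens f g h.

Let L2v j : L2loc (component v j).
Proof. by have [/(_ j)[]] := lame_v. Qed.

Lemma sum_complex n (A B : 'I_n -> R) :
  \sum_(j < n) (A j +i* B j) = (\sum_(j < n) A j) +i* (\sum_(j < n) B j).
Proof. by apply/eqP; rewrite eq_complex !raddf_sum !eqxx. Qed.

Lemma mul_real_complex (a b c : R) : a%:C * (b +i* c) = (a * b) +i* (a * c).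
Proof. by simpc. Qed.

Lemma regular_distribution_toC (u : space3 R -> R[i]) (F : space3 R -> R) :
  regular_distribution u (toC F) = pairing (reC u) F +i* pairing (imC u) F.
Proof.
rewrite /regular_distribution /integralC /pairing; congr (_ +i* _);
  apply: eq_Rintegral => x _; rewrite /reC /imC /toC; case: (u x) => a b /=.
  by rewrite mulr0 subr0.
by rewrite mulr0 add0r.
Qed.

(** The weak equation is tested with the derivative of multi-index [k]. The two signs from moving
    two derivatives cancel, and since the coefficients and the test function are real, the equation
    splits into real and imaginary parts. *)
Lemma lame_pairing (i : 'I_3) k :
  mu * \sum_(j < 3) pairing (re i) (D (incr j (incr j k))) +
  (lambda + mu) * \sum_(j < 3) pairing (re j) (D (incr j (incr i k))) = 0 /\
  mu * \sum_(j < 3) pairing (im i) (D (incr j (incr j k))) +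
  (lambda + mu) * \sum_(j < 3) pairing (im j) (D (incr j (incr i k))) = 0.
Proof.
have dE k' : dcomb f g h [:: (1, k')] = D k'.
  by apply/funext => x; rewrite /dcomb big_seq1 mul1r.
have dpp (u : space3 R -> R[i]) a b : regular_distribution u
      (partialC a (partialC b (toC (dcomb f g h [:: (1, k)])))) =
    pairing (reC u) (D (incr a (incr b k))) +i*
    pairing (imC u) (D (incr a (incr b k))).
  by rewrite !(partialC_dcomb sf sg sh) regular_distribution_toC dE.
have [_ /(_ i)] := lame_v.
move/(_ _ (test_function_dcomb sf sg sh f0 g0 h0 [:: (1, k)] (@subsetT _ _))).
rewrite /lame /dlaplacian /ddiv /dpartial.
under eq_bigr do rewrite opprK dpp.
under [X in _ + _ * - X]eq_bigr do rewrite dpp.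
rewrite -sumrN; under [X in _ + _ * X]eq_bigr do rewrite opprK.
rewrite !sum_complex !mul_real_complex => /eqP.
by rewrite eq_complex /= => /andP[/eqP E1 /eqP E2].
Qed.

Lemma integrable_pairing (j : 'I_3) l :
  (volume R).-integrable setT (EFin \o (fun x => re j x * dcomb f g h l x)) /\
  (volume R).-integrable setT (EFin \o (fun x => im j x * dcomb f g h l x)).
Proof.
have [mr mi /(_ _ (@compact_box R p q)) ib] := L2v j.
by split; apply: (integrable_mul_dcomb sf sg sh f0 g0 h0 _ _ ib) => // x;
  rewrite ?lerDl ?lerDr sqr_ge0.
Qed.

Lemma pairing_bilaplacian (j : 'I_3) :
  pairing (re j) (dcomb f g h (bilaplacian R)) =
    \sum_(c <- bilaplacian R) c.1 * pairing (re j) (D c.2) /\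
  pairing (im j) (dcomb f g h (bilaplacian R)) =
    \sum_(c <- bilaplacian R) c.1 * pairing (im j) (D c.2).
Proof.
have [mr mi /(_ _ (@compact_box R p q)) ib] := L2v j.
by split; apply: (pairing_dcomb sf sg sh f0 g0 h0 _ _ ib) => // x;
  rewrite ?lerDl ?lerDr sqr_ge0.
Qed.

Lemma pairing_sum (m : 'I_3 -> R) (w : 'I_3 -> space3 R -> R)
    (F : space3 R -> R) :
  (forall j, (volume R).-integrable setT (EFin \o (fun x => w j x * F x))) ->
  \int[volume R]_x (\sum_(j < 3) m j * (w j x * F x)) =
  \sum_(j < 3) m j * pairing (w j) F.
Proof.
move=> iw.
have iZ j : (volume R).-integrable setT
    (EFin \o (fun x => m j * (w j x * F x))).
  have := integrableZl measurableT (m j) (iw j).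
  by apply: eq_integrable => // x _ /=; rewrite -EFinM.
under eq_Rintegral do rewrite !big_ord_recl big_ord0 addr0.
rewrite RintegralD//; last first.
  have := integrableD measurableT (iZ (lift ord0 ord0))
    (iZ (lift ord0 (lift ord0 ord0))).
  by apply: eq_integrable => // x _ /=; rewrite -EFinD.
by rewrite RintegralD// !RintegralZl// !big_ord_recl big_ord0 addr0.
Qed.

Lemma orthogonal_bilaplacian (M : 'rV[R]_3) (U : set (space3 R)) :
  0 < mu -> 0 < lambda + 2 * mu -> box p q `<=` U ->
  integralC U (fun x => toC (dcomb f g h (bilaplacian R)) x *
    bilinear_dot (complex_row M) (v x)) = 0.
Proof.
move=> mu0 lm0 KU.
set F := dcomb f g h (bilaplacian R).
(* The argument for one real family [w], applied below to the real and to the imaginary parts; they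
   separate because [M] and [F] are real. *)
have E (w : 'I_3 -> space3 R -> R) (G : space3 R -> R) :
    (forall j, (volume R).-integrable setT (EFin \o (fun x => w j x * F x))) ->
    (forall j, pairing (w j) F =
       \sum_(c <- bilaplacian R) c.1 * pairing (w j) (D c.2)) ->
    (forall (i : 'I_3) k,
       mu * \sum_(j < 3) pairing (w i) (D (incr j (incr j k))) +
       (lambda + mu) *
         \sum_(j < 3) pairing (w j) (D (incr j (incr i k))) = 0) ->
    (forall x, G x = \sum_(j < 3) M ord0 j * (w j x * F x)) ->
    \int[volume R]_(x in U) G x = 0.
  move=> iw pw lw Gw; rewrite Rintegral_mkcond.
  (* [F] vanishes off the box, which lies in [U], so the integral extends to the whole space. *)
  have -> : G \_ U = fun x => \sum_(j < 3) M ord0 j * (w j x * F x).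
    apply/funext => x; rewrite /patch; case: ifPn => [_|]; first exact: Gw.
    rewrite notin_setE => xU; rewrite big1// => j _.
    by rewrite /F (dcomb_off_box f0 g0 h0) ?mulr0// => /KU.
  rewrite pairing_sum//; under eq_bigr do rewrite pw.
  exact: (sum_bilaplacian_eq0 (tau := fun j k => pairing (w j) (D k))
    _ mu0 lm0).
have dotE x : toC F x * bilinear_dot (complex_row M) (v x) =
    (\sum_(j < 3) M ord0 j * (re j x * F x)) +i*
    (\sum_(j < 3) M ord0 j * (im j x * F x)).
  rewrite /bilinear_dot -sum_complex mulr_sumr; apply: eq_bigr => j _.
  rewrite mxE /toC /re /im /reC /imC /component; case: (v x _ _) => a b /=.
  by simpc; rewrite mulrCA [F x * (_ * b)]mulrCA ![F x * _]mulrC.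
rewrite /integralC (E re)//; last 4 first.
- by move=> j; have [] := integrable_pairing j (bilaplacian R).
- by move=> j; have [] := pairing_bilaplacian j.
- by move=> i k; have [] := lame_pairing i k.
- by move=> x; rewrite /reC dotE.
rewrite (E im)//.
- by move=> j; have [] := integrable_pairing j (bilaplacian R).
- by move=> j; have [] := pairing_bilaplacian j.
- by move=> i k; have [] := lame_pairing i k.
- by move=> x; rewrite /imC dotE.
Qed.

End LamePairing.

(** * The bilaplacian of a product of bumps is not identically zero *)

Lemma bilaplacian_neq0 (R : realType) (p q : space3 R) :
  p.1.1 < q.1.1 -> p.1.2 < q.1.2 -> p.2 < q.2 ->
  exists x, dcomb (bump p.1.1 q.1.1) (bump p.1.2 q.1.2) (bump p.2 q.2)
    (bilaplacian R) x != 0.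
Proof.
move=> pq1 pq2 pq3; set f := bump p.1.1 _; set g := bump p.1.2 _.
set h := bump p.2 _; apply: contrapT => no.
pose y := (p.1.2 + q.1.2) / 2; pose z := (p.2 + q.2) / 2.
have gy : g y != 0.
  by rewrite gt_eqF// bump_gt0//; apply/andP; split; rewrite /y; lra.
have hz : h z != 0.
  by rewrite gt_eqF// bump_gt0//; apply/andP; split; rewrite /z; lra.
have E t : dcomb f g h (bilaplacian R) (t, y, z) = 0.
  by apply/eqP; apply: contrapT => /negP F; apply: no; exists (t, y, z).
(* The coefficients come from dividing the equation at (t, y, z) by g(y) h(z) and solving for the
   fourth derivative of [f]. *)
pose a := - (2 * (derive1n 2 g y / g y + derive1n 2 h z / h z)).
pose b := - (derive1n 4 g y / g y + derive1n 4 h z / h z +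
  2 * (derive1n 2 g y / g y) * (derive1n 2 h z / h z)).
have solve_f4 (F4 F2 F G4 G2 G H4 H2 H : R) : G != 0 -> H != 0 ->
    1 * (F4 * G * H) + (1 * (F * G4 * H) + (1 * (F * G * H4) +
      (2 * (F2 * G2 * H) + (2 * (F2 * G * H2) +
      (2 * (F * G2 * H2) + 0))))) = 0 ->
    F4 = - (2 * (G2 / G + H2 / H)) * F2
      + - (G4 / G + H4 / H + 2 * (G2 / G) * (H2 / H)) * F.
  move=> G0 H0 E0; apply: (mulIf (mulf_neq0 G0 H0)).
  by rewrite -[LHS]subr0 -E0; field; rewrite G0 H0.
have ode t : derive1n 4 f t = a * derive1n 2 f t + b * f t.
  have := E t; rewrite /dcomb /bilaplacian !big_cons big_nil /dtens /tens /=.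
  exact: solve_f4 gy hz.
have fle t : t <= p.1.1 -> f t = 0.
  by move=> tp; rewrite /f /bump flat_le0 ?mul0r// subr_le0.
have [d d0 hd] := fourth_order_Cauchy0 (@smooth1_bump R _ _) fle ode.
(* A point where uniqueness forces [f] to vanish although the bump is positive there. *)
have [t /andP[pt tq]] : exists t, p.1.1 < t < Num.min (p.1.1 + d) q.1.1.
  have pm : p.1.1 < Num.min (p.1.1 + d) q.1.1 by rewrite lt_min pq1 ltrDl d0.
  by exists ((p.1.1 + Num.min (p.1.1 + d) q.1.1) / 2); rewrite !midf_lt.
move: tq; rewrite lt_min => /andP[td tq].
have ft : f t = 0 by apply: hd; rewrite pt.
have : 0 < f t by apply: bump_gt0; rewrite pt.
by rewrite ft ltxx.
Qed.

(** * Linear independence and disjoint boxes inside the cylinder *)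

Section ProofOfTheTheorem.
Local Open Scope classical_set_scope.
Variable R : realType.

(** Evaluating a linear relation at a point where [w i] is nonzero kills all other terms. *)
Lemma linearly_independent_disjoint (w : nat -> space3 R -> R[i])
    (K : nat -> set (space3 R)) :
  (forall n x, ~ K n x -> w n x = 0) -> (forall n, exists x, w n x != 0) ->
  (forall m n x, K m x -> K n x -> m = n) -> linearly_independent w.
Proof.
move=> wK w0 Kd n c cw i.
have [x wx] := w0 i.
have Kx : K i x by apply: contrapT => /wK; exact/eqP.
have := cw x; rewrite (bigD1 i)//= big1 ?addr0; last first.
  move=> j ji; rewrite wK ?mulr0// => Kj; move/negP: ji; apply.
  by apply/eqP/val_inj/(Kd _ _ _ Kj Kx).
by move/eqP; rewrite mulf_eq0 (negbTE wx) orbF => /eqP.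
Qed.

Lemma open_cylinder_box (D : set (R * R)) (tm tp : R) :
  open D -> D !=set0 -> tm < tp ->
  exists (p q : space3 R), [/\ p.1.1 < q.1.1, p.1.2 < q.1.2, p.2 < q.2 &
    box p q `<=` D `*` `]tm, tp[].
Proof.
move=> oD [[a b] Dab] tmp.
have [[U V] /= [nU nV] UVD] : nbhs (a, b) D by exact: open_nbhs_nbhs.
have [e e0 eU] : exists2 e, 0 < e & ball a e `<=` U.
  by move/nbhs_ballP : nU => [e e0 eU]; exists e.
have [d d0 dV] : exists2 e, 0 < e & ball b e `<=` V.
  by move/nbhs_ballP : nV => [d d0 dV]; exists d.
(* The point (a, b) is a corner of the base; half the radii keeps the closed base in the open balls,
   and the height is the middle half of the interval. *)
exists (a, b, tm + (tp - tm) / 4), (a + e / 2, b + d / 2, tp - (tp - tm) / 4).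
split => /=; [lra|lra|lra|].
move=> [[x y] z] [[/=]].
rewrite !in_itv/= => /andP[x1 x2] /andP[y1 y2] /andP[z1 z2].
split => /=; last by rewrite ?in_itv/=; apply/andP; split; lra.
apply: UVD; split => /=.
  by apply: eU; rewrite /ball /= ler0_norm; lra.
by apply: dV; rewrite /ball /= ler0_norm; lra.
Qed.

End ProofOfTheTheorem.
Theorem proposition3p5 (R : realType) (lambda mu : R)
    (mu_gt0 : 0 < mu) (lambda_2mu_gt0 : 0 < lambda + 2 * mu)
    (D : set (R * R)) (D_nonempty : D !=set0) (D_bounded : bounded_set D)
    (D_open : open D) (tm tp : R) (tm_lt_tp : tm < tp)
    (M : 'rV[R]_3) (M_neq0 : M != 0) :
  let Q := (D `*` `]tm, tp[) in
  exists omega : nat -> space3 R -> R[i],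
    [/\ forall n, test_function Q (omega n),
        linearly_independent omega &
        forall n v, lame_solutions lambda mu v ->
          integralC Q (fun x =>
            omega n x * bilinear_dot (complex_row M) (v x)) = 0].
Proof.
move=> Q.
have [p [q [pq1 pq2 pq3 pqQ]]] := open_cylinder_box D_open D_nonempty tm_lt_tp.
(* [c] is decreasing, so the intervals [[c n.*2.+1, c n.*2]] are disjoint. *)
pose c n : R := p.1.1 + (q.1.1 - p.1.1) / n.+1%:R.
have c_lt m n : (m < n)%N -> c n < c m.
  move=> mn; rewrite ltrD2l ltr_pM2l ?subr_gt0//.
  by rewrite ltf_pV2 ?posrE ?ltr0n// ltr_nat ltnS.
have p_lt n : p.1.1 < c n by rewrite ltrDl divr_gt0 ?subr_gt0 ?ltr0n.
pose P n : space3 R := (c n.*2.+1, p.1.2, p.2).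
pose S n : space3 R := (c n.*2, q.1.2, q.2).
have boxQ n : box (P n) (S n) `<=` Q.
  move=> [[x y] z] [[/=]]; rewrite !in_itv/= => /andP[x1 x2] yb zb; apply: pqQ.
  split => //; split => //=; rewrite in_itv/=; apply/andP; split.
    by apply: le_trans x1; exact: ltW.
  (* The denominator in [c] is shifted by one, so the sequence starts at the right end. *)
  have -> : q.1.1 = c 0%N by rewrite /c divr1 addrC subrK.
  apply: (le_trans x2); case: n {x1 x2} => [//|n].
  by apply/ltW/c_lt.
pose w n := dcomb (bump (P n).1.1 (S n).1.1) (bump (P n).1.2 (S n).1.2)
  (bump (P n).2 (S n).2) (bilaplacian R).
have sb a b : smooth1 (@bump R a b) by exact: smooth1_bump.
have bz a b : zero_off (@bump R a b) a b by exact: bump_zero_off.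
exists (fun n => toC (w n)); split.
- by move=> n; apply: test_function_dcomb => //; exact: boxQ.
- apply: (@linearly_independent_disjoint _ _ (fun n => box (P n) (S n))).
  + move=> n x xb; rewrite /toC /w.
    by rewrite (dcomb_off_box (bz _ _) (bz _ _) (bz _ _)).
  + move=> n.
    have [x wx] := @bilaplacian_neq0 R (P n) (S n)
      (c_lt _ _ (ltnSn _)) pq2 pq3.
    by exists x; rewrite /toC eq_complex /= negb_and wx.
  + move=> m n x [[/= + _] _] [[/= + _] _]; rewrite !in_itv/=.
    move=> /andP[m1 m2] /andP[n1 n2].
    (* If i < j then 2i + 1 < 2j, and [c] decreasing puts the j-th interval strictly to the left of
       the i-th. Used in both directions, this gives m = n. *)
    have aux i j : c i.*2.+1 <= x.1.1 -> x.1.1 <= c j.*2 -> (j <= i)%N.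
      move=> ix xj; rewrite leqNgt; apply/negP => ij.
      by have := le_trans ix xj; rewrite leNgt c_lt// ltn_Sdouble.
    by apply/eqP; rewrite eqn_leq (aux _ _ n1 m2) (aux _ _ m1 n2).
- move=> n v lv; apply: (orthogonal_bilaplacian _ _ _ _ _ _ lv) => //.
Qed.
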